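(* Let $D>1$ be real and let $(V,\omega,\mu)$ be the radial path graph with parameter $D$ (defined in the context). Then the following estimates hold. (i) If $p>D$, there exists a constant $C>0$, depending only on $p,D$, such that, for every nonempty finite subset $\Omega\subset V$ with $\tau_\Omega\ge2$, $$\mathcal{R}_p(\Omega)\le C\,\tau_\Omega^{\,p-D}.$$ (ii) If $p=D$, there exists a constant $C>0$, depending only on $D$, such that, for every nonempty finite subset $\Omega\subset V$ with $\tau_\Omega\ge2$, $$\mathcal{R}_p(\Omega)\le C(\log\tau_\Omega)^{p-1}.$$ (iii) If $1<p<D$ and $s>D/p$, there exists a constant $C>0$, depending only on $p,D,s$, such that, for every nonempty finite subset $\Omega\subset V$ with $\tau_\Omega\ge2$, $$\mathcal{R}_{p,s}(\Omega)\le C\,\tau_\Omega^{\,p-\frac{D}{s}}.$$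
   Context: The radial path graph with parameter $D>1$ has vertex set $V=\mathbb{N}_0=\{0,1,2,\dots\}$, adjacency $m\sim n$ iff $|m-n|=1$, vertex measure $\mu(n)=(n+1)^{D-1}$, and edge weights $\omega_{n,n+1}=\omega_{n+1,n}=(n+1)^{D-1}$ for $n\in\mathbb{N}_0$, all other weights being zero. For a nonempty finite $\Omega\subset V$, the radial outer radius is $\tau_\Omega=\max\{n:n\in\Omega\}$. For a nonempty finite $\Omega\subset V$: $X_V(\Omega)=\{u:V\to\mathbb{R}:u=0\text{ in }V\setminus\Omega\}$; for $1<p<\infty$, $E_p(u)=\frac12\sum_{x,y\in V}\omega_{xy}|u(y)-u(x)|^p$; for $1\le r<\infty$, $\|u\|_{\ell^r(\Omega,\mu)}=(\sum_{x\in\Omega}\mu(x)|u(x)|^r)^{1/r}$; for $x\in\Omega$, $\operatorname{Cap}_p(x,\Omega)=\inf\{E_p(\varphi):\varphi\in X_V(\Omega),\varphi(x)=1\}\in(0,\infty)$. The capacitary radii are $$\mathcal{R}_p(\Omega)=\max_{x\in\Omega}\operatorname{Cap}_p(x,\Omega)^{-1},\qquad \mathcal{R}_{p,s}(\Omega)=\max_{u\in X_V(\Omega),\,u\not\equiv0}\frac{\|u\|_{\ell^{ps'}(\Omega,\mu)}^p}{E_p(u)}\quad(1<s<\infty),$$ where $s'=s/(s-1)$. *)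

(* Defs.v *)
From HB Require Import structures.
From mathcomp Require Import all_boot all_order all_algebra finmap.
From mathcomp Require Import all_classical all_reals all_analysis.

Set Implicit Arguments.
Unset Strict Implicit.
Unset Printing Implicit Defensive.
Import Order.TTheory GRing.Theory Num.Theory.
Import numFieldNormedType.Exports.

Local Open Scope classical_set_scope.
Local Open Scope ring_scope.

(* Energies, capacities and radii are valued in [\bar R], with [0^-1 = +oo]:
   an infinite energy, a zero capacity or an unbounded quotient then shows up
   as an infinite value instead of a default real number. *)

Section weighted_graph.
Variables (R : realType) (V : choiceType).
Variables (omega : V -> V -> R) (mu : V -> R).

Definition XV (Omega : {fset V}) : set (V -> R) :=
  [set u | forall x, x \notin Omega -> u x = 0].

(* The sum is over ordered pairs, so each edge is counted twice. *)
Definition energy (p : R) (u : V -> R) : \bar R :=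
  ((2^-1)%:E * \esum_(e in [set: V * V])
     (omega e.1 e.2 * `|u e.2 - u e.1| `^ p)%:E)%E.

Definition lnorm (r : R) (Omega : {fset V}) (u : V -> R) : R :=
  (\sum_(x <- Omega) mu x * `|u x| `^ r) `^ r^-1.

Definition Cap (p : R) (x : V) (Omega : {fset V}) : \bar R :=
  ereal_inf [set energy p phi | phi in [set phi | XV Omega phi /\ phi x = 1]].

Definition cap_radius (p : R) (Omega : {fset V}) : \bar R :=
  (\big[maxe/-oo]_(x <- Omega) (Cap p x Omega)^-1)%E.

Definition conj_exponent (s : R) : R := s / (s - 1).

(* The supremum is the maximum whenever the latter exists. *)
Definition cap_radius_s (p s : R) (Omega : {fset V}) : \bar R :=
  ereal_sup [set ((lnorm (p * conj_exponent s) Omega u `^ p)%:E / energy p u)%E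
            | u in [set u | XV Omega u /\ u <> cst 0]].

End weighted_graph.

Section radial_path.
Variables (R : realType) (D : R).

Definition radial_adj (m n : nat) : bool := (n == m.+1) || (m == n.+1).

Definition radial_weight (m n : nat) : R :=
  if radial_adj m n then (minn m n).+1%:R `^ (D - 1) else 0.

Definition radial_measure (n : nat) : R := n.+1%:R `^ (D - 1).

End radial_path.

Definition outer_radius (Omega : {fset nat}) : nat := (\max_(n <- Omega) n)%N.

(* Main.v *)
Require Import Defs.
From HB Require Import structures.
From mathcomp Require Import all_boot all_order all_algebra finmap.
From mathcomp Require Import all_classical all_reals all_analysis.
From mathcomp Require Import ring lra.

Import Order.TTheory GRing.Theory Num.Theory.
Import numFieldNormedType.Exports.

Local Open Scope ring_scope.

(** Let [T] be the outer radius of [Omega].  A function [u] vanishing off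
    [Omega] vanishes at [T.+1], so [u x] is minus the sum of the increments of
    [u] along the path from [x] to [T.+1].  Hoelder's inequality with the edge
    weights gives
      [`|u x| `^ p <= S(x) `^ (p - 1) * energy p u],
    where [S(x)] is the sum over [x <= n <= T] of [n.+1 `^ - a], and
    [a = (D - 1) / (p - 1)] ([powR_normr_le_edge_energy]).  Everything then
    rests on the size of this one power sum, and the three regimes are those of
    [a] relative to 1.

    If [p > D] then [a < 1] and [S(0)] is of order [T `^ (1 - a)]; as
    [(1 - a) (p - 1) = p - D], this bounds the inverse capacities.  If [p = D]
    then [a = 1] and [S(0)] is a harmonic sum, of order [ln T].

    If [p < D] then [a > 1], and the tail of the convergent series gives
    [S(x) <= C x.+1 `^ (1 - a)], hence the pointwise decay
    [`|u x| `^ p <= C x.+1 `^ (p - D) * energy p u].  Integrating the power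
    [s' = s / (s - 1)] of this bound against the measure [x.+1 `^ (D - 1)] leaves
    the sum of [x.+1 `^ e] with [e = D - 1 + (p - D) s'].  The hypothesis
    [s > D / p] is exactly [e > -1], so the sum is of order [T `^ (e + 1)], and
    [(e + 1) / s' = p - D / s] is the required exponent ([lnorm_powR_le]).

    Both Hoelder's inequality (in the division-free form [sum_powR_radon]) and
    the power sums are obtained from tangent lines of powers and of the
    logarithm: the former after summation over the indices, the latter because
    the tangent inequalities compare each term with a telescoping increment. *)

(** * Tangent-line inequalities for powers and the logarithm *)

Section power_inequalities.
Context {R : realType}.
Implicit Types b g p r t x y : R.

Lemma ler_powR_base {r x y} : 0 <= r -> 0 <= x -> x <= y -> x `^ r <= y `^ r.
Proof.
by move=> r0 x0 xy; apply: ge0_ler_powR; rewrite ?nnegrE// (le_trans x0).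
Qed.

(** Weighted AM-GM: Young's inequality applied to [x `^ b] and [y `^ (1 - b)]. *)
Lemma powR_amgm b x y : 0 < b < 1 -> 0 <= x -> 0 <= y ->
  x `^ b * y `^ (1 - b) <= b * x + (1 - b) * y.
Proof.
move=> /andP[b0 b1] x0 y0.
have := @conjugate_powR R (x `^ b) (y `^ (1 - b)) b^-1 (1 - b)^-1.
rewrite !invrK -!powRrM !mulfV ?gt_eqF ?subr_gt0// !powRr1//.
rewrite ![_ * b]mulrC [_ * (1 - b)]mulrC.
by apply; rewrite ?powR_ge0 ?invr_gt0 ?subr_gt0//; ring.
Qed.

(** The tangent line of the convex power [x `^ p] at [t] lies below the curve:
    AM-GM for [x `^ p] and [t `^ p] with weight [p^-1]. *)
Lemma powR_tangent p x t : 1 < p -> 0 <= x -> 0 <= t ->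
  p * (x * t `^ (p - 1)) - (p - 1) * t `^ p <= x `^ p.
Proof.
move=> p1 x0 t0; have p0 : 0 < p by rewrite (lt_trans _ p1).
have pn0 : p != 0 by rewrite gt_eqF.
have := @powR_amgm p^-1 (x `^ p) (t `^ p).
rewrite invr_gt0 p0 invf_lt1// p1 => /(_ isT (powR_ge0 _ _) (powR_ge0 _ _)).
rewrite -!powRrM mulfV// powRr1// mulrBr mulr1 mulfV//.
rewrite -(ler_pM2l p0) => h.
have -> : x `^ p = p * (p^-1 * x `^ p) by rewrite mulVKf.
rewrite lerBlDr (le_trans h)// le_eqVlt; apply/orP; left; apply/eqP.
by field.
Qed.

(** Radon's inequality, that is, Hoelder's inequality for [d = w * (d / w)]: add
    up, with the weights [w i], the tangent inequalities at the mean slope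
    [t = \sum d / \sum w] for the points [d i / w i].  By the choice of [t] the
    linear terms cancel in the sum. *)
Lemma sum_powR_radon p (I : Type) (r : seq I) (w d : I -> R) : 1 < p ->
  (forall i, 0 < w i) -> (forall i, 0 <= d i) ->
  (\sum_(i <- r) d i) `^ p
    <= (\sum_(i <- r) w i) `^ (p - 1) *
       \sum_(i <- r) w i `^ (1 - p) * d i `^ p.
Proof.
move=> p1 w0 d0; have p0 : 0 < p by rewrite (lt_trans _ p1).
case: r => [|i0 r]; first by rewrite !big_nil mulr0 powR0// gt_eqF.
set S := \sum_(i <- _) w i; set A := \sum_(i <- _) d i.
have A0 : 0 <= A by exact: sumr_ge0.
have S0 : 0 < S by rewrite /S big_cons ltr_wpDr// sumr_ge0// => i _; exact: ltW.
pose t := A / S; have t0 : 0 <= t by rewrite divr_ge0// ltW.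
have term i : p * t `^ (p - 1) * d i - (p - 1) * t `^ p * w i
    <= w i `^ (1 - p) * d i `^ p.
  have dw0 : 0 <= d i / w i by rewrite divr_ge0// ltW.
  have := powR_tangent p (d i / w i) t p1 dw0 t0.
  rewrite -(ler_pM2l (w0 i)).
  have -> : w i * (d i / w i) `^ p = w i `^ (1 - p) * d i `^ p.
    have wi0 := ltW (w0 i).
    rewrite powRM ?invr_ge0// powRB ?(gt_eqF (w0 i)) ?implybT// powRr1//.
    by rewrite -powR_inv1// -powRrM mulN1r powRN; ring.
  apply: le_trans; rewrite le_eqVlt; apply/orP; left; apply/eqP.
  by field; rewrite gt_eqF.
have total : S * t `^ p <= \sum_(i <- i0 :: r) w i `^ (1 - p) * d i `^ p.
  apply: le_trans (ler_sum _ (fun i _ => term i)).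
  rewrite sumrB -!mulr_sumr -/A -/S.
  have -> : A = S * t by rewrite /t mulrCA mulfV ?gt_eqF// mulr1.
  rewrite -[t `^ p](mulr_powRB1 t0 p0) le_eqVlt; apply/orP; left; apply/eqP; ring.
apply: le_trans (ler_wpM2l (powR_ge0 S (p - 1)) total).
rewrite mulrA [_ * S]mulrC (mulr_powRB1 (ltW S0))// -powRM ?(ltW S0)//.
by rewrite /t mulrCA mulfV ?gt_eqF// mulr1.
Qed.

(** The concave power [x `^ b] lies below its tangent at [n.+1]. *)
Lemma powR_succ_concave b n : 0 < b < 1 ->
  b * n.+1%:R `^ (b - 1) <= (n.+1%:R `^ b - n%:R `^ b : R).
Proof.
move=> hb; set x : R := n.+1%:R; have x0 : 0 < x by rewrite ltr0n.
have h := powR_amgm b n%:R x hb (ler0n _ _) (ltW x0).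
have xb0 : 0 < x `^ (1 - b) by rewrite powR_gt0.
have e1 : x `^ (b - 1) * x `^ (1 - b) = 1.
  by rewrite -powRD ?(gt_eqF x0) ?implybT// addrC subrKA subrr powRr0.
have e2 : x `^ b * x `^ (1 - b) = x.
  by rewrite -powRD ?(gt_eqF x0) ?implybT// subrKC powRr1// ltW.
rewrite -(ler_pM2r xb0) mulrBl -mulrA e1 e2; move: h; rewrite /x -(natr1 n); lra.
Qed.

(** The convex power [x `^ - g] lies above its tangent at [n.+2]; after division
    by [n.+2 `^ - g] this is [q `^ - g >= 1 - g * ln q >= 1 + g * (1 - q)] for the
    ratio [q = n.+1 / n.+2]. *)
Lemma powRN_succ_convex g n : 0 < g ->
  g * n.+2%:R `^ (- (g + 1)) <= (n.+1%:R `^ (- g) - n.+2%:R `^ (- g) : R).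
Proof.
move=> g0; set y : R := n.+2%:R; have y0 : 0 < y by rewrite ltr0n.
pose q : R := n.+1%:R / y; have q0 : 0 < q by rewrite divr_gt0 ?ltr0n.
have qE : q = 1 - y^-1.
  by rewrite /q -[n.+1%:R](addrK 1) natr1 /y mulrBl mul1r mulfV// pnatr_eq0.
have q1 : 1 + g * y^-1 <= q `^ (- g).
  rewrite /powR gt_eqF// (le_trans _ (expR_ge1Dx _))// lerD2l mulNr -mulrN.
  rewrite ler_pM2l// lerNr qE; apply: le_ln1Dx.
  by rewrite ltrN2 invf_lt1// ltr1n.
have -> : n.+1%:R `^ (- g) = y `^ (- g) * q `^ (- g).
  by rewrite -powRM ?ltW// mulrC mulfVK ?gt_eqF.
have yg : 0 < y `^ (- g) by rewrite powR_gt0.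
have := q1; rewrite -(ler_pM2l yg) opprD powRD ?(gt_eqF y0) ?implybT// (powR_inv1 (ltW y0)).
by rewrite mulrDr mulr1 mulrCA lerBrDl.
Qed.

Lemma ln_succ_concave n : n.+2%:R^-1 <= (ln n.+2%:R - ln n.+1%:R : R).
Proof.
have qE : n.+1%:R / n.+2%:R = 1 - n.+2%:R^-1 :> R.
  by rewrite -[n.+1%:R](addrK 1) natr1 mulrBl mul1r mulfV// pnatr_eq0.
rewrite -opprB lerNr -ln_div ?posrE ?ltr0n// qE; apply: le_ln1Dx.
by rewrite ltrN2 invf_lt1// ?ltr1n ?ltr0n.
Qed.

End power_inequalities.

(** * Power sums *)

Section power_sums.
Context {R : realType}.
Implicit Types a c : R.

(** For [c >= 0] every term is at most [N `^ c]; for [-1 < c < 0] the terms are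
    dominated by the increments of [n `^ (c + 1)].  The constant covers both
    cases. *)
Lemma sum_powR_le c N : -1 < c ->
  \sum_(0 <= n < N) n.+1%:R `^ c <= (1 + (c + 1)^-1) * N%:R `^ (c + 1) :> R.
Proof.
move=> c1; have c10 : 0 < c + 1 by lra.
have [c0|c0] := leP 0 c.
  apply: (@le_trans _ _ (N%:R `^ (c + 1))); last first.
    by rewrite ler_peMl ?powR_ge0// lerDl invr_ge0 ltW.
  apply: (@le_trans _ _ (\sum_(0 <= n < N) N%:R `^ c)).
    apply: ler_sum_nat => n /andP[_ nN].
    by rewrite ler_powR_base// ler_nat.
  by rewrite sumr_const_nat subn0 -[X in X <= _]mulr_natl -{1}(addrK 1 c) mulr_powRB1.
apply: (@le_trans _ _ ((c + 1)^-1 * N%:R `^ (c + 1))); last first.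
  by rewrite ler_wpM2r ?powR_ge0// lerDr.
rewrite -(ler_pM2l c10) mulVKf ?gt_eqF// mulr_sumr.
apply: (@le_trans _ _ (\sum_(0 <= n < N) (n.+1%:R `^ (c + 1) - n%:R `^ (c + 1)))).
  apply: ler_sum_nat => n _.
  by have := @powR_succ_concave R (c + 1) n; rewrite addrK; apply; lra.
by rewrite (telescope_sumr (fun n => n%:R `^ (c + 1)))// powR0 ?subr0// gt_eqF.
Qed.

(** The terms are dominated by the decrements of [n.+1 `^ (1 - a)].  The factor
    [2 `^ a] pays for the tangent being taken at [n.+2] instead of [n.+1]. *)
Lemma sum_powRN_tail_le a x N : 1 < a ->
  \sum_(x <= n < N) n.+1%:R `^ (- a)
    <= 2 `^ a / (a - 1) * x.+1%:R `^ (1 - a) :> R.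
Proof.
move=> a1; have a10 : 0 < a - 1 by lra.
have K0 : 0 <= 2 `^ a / (a - 1) by rewrite divr_ge0 ?powR_ge0 ?ltW.
have [Nx|xN] := leqP N x; first by rewrite big_geq// mulr_ge0 ?powR_ge0.
apply: (@le_trans _ _ (\sum_(x <= n < N) 2 `^ a / (a - 1) *
    - (n.+2%:R `^ (1 - a) - n.+1%:R `^ (1 - a)))).
  apply: ler_sum_nat => n _; rewrite opprB.
  have := @powRN_succ_convex R (a - 1) n a10; rewrite subrK opprB => h.
  rewrite -mulrA mulrC -ler_pdivrMr ?powR_gt0// ler_pdivlMl// mulrC.
  apply: le_trans h; rewrite mulrC ler_pM2l// -powRN -powRM//.
  rewrite !powRN lef_pV2 ?posrE ?powR_gt0 ?mulr_gt0//.
  apply: ler_powR_base => //; first by lra.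
  by rewrite -natrM ler_nat mulnC mul2n -addnn addSn ltnS addnS ltnS leq_addr.
rewrite -mulr_sumr ler_wpM2l// sumrN.
rewrite (telescope_sumr (fun n => n.+1%:R `^ (1 - a))) ?(ltnW xN)// opprB.
by rewrite gerBl powR_ge0.
Qed.

Lemma sum_inv_le_ln N : \sum_(0 <= n < N.+1) n.+1%:R^-1 <= 1 + ln N.+1%:R :> R.
Proof.
elim: N => [|N IH]; first by rewrite big_nat1 invr1 ln1 addr0.
rewrite big_nat_recr//=; apply: le_trans (lerD IH (ln_succ_concave N)) _.
by rewrite -addrA subrKC.
Qed.

End power_sums.

(** * Energy and pointwise values on the radial path *)

Section radial_energy.
Context {R : realType} (D : R).

(** The energy of the first [N] edges, each edge counted once. *)
Definition edge_energy (p : R) (u : nat -> R) (N : nat) : R :=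
  \sum_(0 <= n < N) n.+1%:R `^ (D - 1) * `|u n.+1 - u n| `^ p.

Lemma edge_energy_ge0 p u N : 0 <= edge_energy p u N.
Proof. by apply: sumr_ge0 => n _; rewrite mulr_ge0 ?powR_ge0. Qed.

(** The factor 1/2 in the energy compensates the two orientations of each edge. *)
Lemma le_edge_energy p u N :
  ((edge_energy p u N)%:E <= energy (radial_weight D) p u)%E.
Proof.
pose f (e : nat * nat) : R := radial_weight D e.1 e.2 * `|u e.2 - u e.1| `^ p.
pose s := [seq (n, n.+1) | n <- index_iota 0 N] ++
          [seq (n.+1, n) | n <- index_iota 0 N].
have us : uniq s.
  rewrite cat_uniq !map_inj_uniq ?iota_uniq //=; last first.
  - by move=> m n [->].
  - by move=> m n [->].
  rewrite andbT; apply/hasPn => _ /mapP[m _ ->]; apply/mapP => -[n _ [<- mE]].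
  by have := leqnSn m.+1; rewrite -mE ltnn.
have sumE : \sum_(e <- s) f e = 2 * edge_energy p u N.
  rewrite big_cat !big_map mulr2n mulrDl mul1r; congr (_ + _); apply: eq_bigr => n _.
    by rewrite /f /radial_weight /radial_adj /= eqxx (minn_idPl (leqnSn n)).
  by rewrite /f /radial_weight /radial_adj /= eqxx orbT (minn_idPr (leqnSn n)) distrC.
rewrite /energy lee_pdivlMl// -EFinM -sumE -sumEFin.
apply: esum_ge; exists [set` s]%classic; first by split => //; exact: finite_seq.
by rewrite -fsbig_seq.
Qed.

(** Telescoping from [x] to [N] followed by Radon's inequality.  The weights
    [w n = n.+1 `^ - ((D - 1) / (p - 1))] are those for which [w n `^ (1 - p)] is
    the edge weight [n.+1 `^ (D - 1)]. *)
Lemma powR_normr_le_edge_energy p u x N : 1 < p -> u N = 0 -> (x <= N)%N ->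
  `|u x| `^ p
    <= (\sum_(x <= n < N) n.+1%:R `^ (- ((D - 1) / (p - 1)))) `^ (p - 1)
       * edge_energy p u N.
Proof.
move=> p1 uN xN; have p0 : 0 < p by rewrite (lt_trans _ p1).
have ux : `|u x| <= \sum_(x <= n < N) `|u n.+1 - u n|.
  apply: le_trans (ler_norm_sum _ _ _).
  by rewrite (telescope_sumr u xN) uN sub0r normrN.
apply: le_trans (ler_powR_base (ltW p0) _ ux) _ => //.
pose w n : R := n.+1%:R `^ (- ((D - 1) / (p - 1))).
apply: le_trans (sum_powR_radon p _ _ w _ p1 _ _) _ => //.
  by move=> n; rewrite powR_gt0// ltr0n.
rewrite ler_wpM2l ?powR_ge0// /edge_energy (big_cat_nat (leq0n x) xN) //=.
rewrite ler_wpDl ?sumr_ge0//.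
apply: ler_sum => n _; rewrite -powRrM.
have -> // : - ((D - 1) / (p - 1)) * (1 - p) = D - 1.
by field; rewrite subr_eq0 gt_eqF.
Qed.

End radial_energy.

(** * Bounds for the capacitary radii *)

Section radii.
Context {R : realType}.

Lemma inve_le_fin (B : R) (y : \bar R) :
  0 < B -> (B^-1%:E <= y)%E -> (y^-1 <= B%:E)%E.
Proof.
move=> B0 hy.
have y0 : (0 <= y)%E by apply: le_trans hy; rewrite lee_fin invr_ge0 ltW.
by rewrite inve_ple ?inE ?lee_fin ?(ltW B0)// inver gt_eqF.
Qed.

Lemma outer_radius_ge (Omega : {fset nat}) x :
  x \in Omega -> (x <= outer_radius Omega)%N.
Proof. by move=> xO; exact: (@leq_bigmax_seq _ _ xpredT id). Qed.

Lemma XV_outer_radius (Omega : {fset nat}) (u : nat -> R) :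
  XV Omega u -> u (outer_radius Omega).+1 = 0.
Proof. by apply; apply: contraTN isT => /outer_radius_ge; rewrite ltnn. Qed.

(** Every competitor for the capacity at [x] takes the value 1 there, so the
    pointwise estimate bounds its energy from below, uniformly in [x]. *)
Lemma cap_radius_le (D p B : R) (Omega : {fset nat}) : 1 < p -> 0 < B ->
  (\sum_(0 <= n < (outer_radius Omega).+1)
     n.+1%:R `^ (- ((D - 1) / (p - 1)))) `^ (p - 1) <= B ->
  (cap_radius (radial_weight D) p Omega <= B%:E)%E.
Proof.
move=> p1 B0 hB; rewrite /cap_radius big_seq.
elim/big_ind : _ => [|a b ha hb|x xO]; rewrite ?leNye ?ge_max ?ha//.
apply: inve_le_fin => //; apply: le_ereal_inf_tmp => _ [phi [Xphi phi1] <-].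
apply: le_trans (le_edge_energy D p phi (outer_radius Omega).+1).
rewrite lee_fin -(ler_pM2l B0) mulfV ?gt_eqF//.
have xN : (x <= (outer_radius Omega).+1)%N by rewrite leqW// outer_radius_ge.
have := powR_normr_le_edge_energy D p phi x _ p1 (XV_outer_radius _ _ Xphi) xN.
rewrite phi1 normr1 powR1 => /le_trans; apply.
rewrite ler_wpM2r ?edge_energy_ge0// (le_trans _ hB)//.
apply: ler_powR_base; rewrite ?sumr_ge0// ?subr_ge0 ?(ltW p1)//.
by rewrite [X in _ <= X](big_cat_nat (leq0n x) xN)//= lerDr sumr_ge0.
Qed.


Lemma succ_powR_le (c : R) (T : nat) : 0 <= c -> (0 < T)%N ->
  T.+1%:R `^ c <= 2 `^ c * T%:R `^ c :> R.
Proof.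
move=> c0 T0; rewrite -powRM//; apply: ler_powR_base => //.
by rewrite -natrM ler_nat mul2n -addnn -addn1 leq_add2l.
Qed.

(** For [p < D] the tail of the convergent series of weights yields decay in
    [x], uniformly in [N]. *)
Lemma powR_normr_le_subcritical (D p : R) (u : nat -> R) x N
    (a := (D - 1) / (p - 1)) :
  1 < p -> p < D -> u N = 0 -> (x <= N)%N ->
  `|u x| `^ p <=
    (2 `^ a / (a - 1)) `^ (p - 1) * edge_energy D p u N * x.+1%:R `^ (p - D).
Proof.
move=> p1 pD uN xN; have p10 : 0 < p - 1 by rewrite subr_gt0.
have a1 : 1 < a by rewrite ltr_pdivlMr// mul1r ltrD2r.
have K0 : 0 <= 2 `^ a / (a - 1) by rewrite divr_ge0 ?powR_ge0// subr_ge0 ltW.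
apply: le_trans (powR_normr_le_edge_energy D p u x N p1 uN xN) _.
rewrite mulrAC ler_wpM2r ?edge_energy_ge0//.
have -> : p - D = (1 - a) * (p - 1) by rewrite /a; field; rewrite gt_eqF.
rewrite (powRrM x.+1%:R) -powRM ?powR_ge0//.
apply: ler_powR_base (ltW p10) _ (sum_powRN_tail_le a x N a1).
by rewrite sumr_ge0.
Qed.

(** Integrated form of the pointwise decay.  The condition [D / p < s] is what
    makes the exponent [e] below larger than -1. *)
Lemma lnorm_powR_le (D p s : R) : 1 < p -> p < D -> D / p < s ->
  exists2 C : R, 0 < C & forall (Omega : {fset nat}) (u : nat -> R), XV Omega u ->
    lnorm (radial_measure D) (p * conj_exponent s) Omega u `^ p <=
    C * (outer_radius Omega).+1%:R `^ (p - D / s)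
      * edge_energy D p u (outer_radius Omega).+1.
Proof.
move=> p1 pD sD; set s' := conj_exponent s; set a := (D - 1) / (p - 1).
have p0 : 0 < p by rewrite (lt_trans _ p1).
have Dps : D < s * p by rewrite -ltr_pdivrMr.
have s1 : 1 < s by apply: lt_trans sD; rewrite ltr_pdivlMr// mul1r.
have s10 : 0 < s - 1 by rewrite subr_gt0.
have s0 : 0 < s by rewrite (lt_trans _ s1).
have s'0 : 0 < s' by rewrite divr_gt0.
have a1 : 0 < a - 1 by rewrite subr_gt0 ltr_pdivlMr ?mul1r ?ltrD2r ?subr_gt0.
pose e := D - 1 + (p - D) * s'.
have e1 : 0 < e + 1.
  have -> : e + 1 = (s * p - D) / (s - 1).
    by rewrite /e /s' /conj_exponent; field; rewrite gt_eqF.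
  by rewrite divr_gt0// subr_gt0.
have expE : (e + 1) / s' = p - D / s.
  by rewrite /e /s' /conj_exponent; field; rewrite !gt_eqF.
have eE : e = D - 1 + (p - D) * s' by [].
clearbody e s'.
pose K := (2 `^ a / (a - 1)) `^ (p - 1).
have K0 : 0 < K by rewrite powR_gt0// divr_gt0// powR_gt0.
pose M := 1 + (e + 1)^-1; have M0 : 0 < M by rewrite ltr_pwDl// invr_ge0 ltW.
exists (K * M `^ s'^-1); first by rewrite mulr_gt0// powR_gt0.
move=> Omega u Xu; set N := (outer_radius Omega).+1.
have uN : u N = 0 by exact: XV_outer_radius.
set E := edge_energy D p u N; have E0 : 0 <= E by exact: edge_energy_ge0.
have KE0 : 0 <= K * E by rewrite mulr_ge0// ltW.
have term n : (n < N)%N -> radial_measure D n * `|u n| `^ (p * s') <=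
    (K * E) `^ s' * n.+1%:R `^ e.
  move=> nN; rewrite eE powRD ?pnatr_eq0 ?implybT// mulrCA ler_wpM2l ?powR_ge0//.
  rewrite !powRrM -powRM ?powR_ge0//; apply: (ler_powR_base (ltW s'0) (powR_ge0 _ _)).
  exact: powR_normr_le_subcritical (ltnW nN).
have sumO : \sum_(x <- Omega) radial_measure D x * `|u x| `^ (p * s') <=
    (K * E) `^ s' * (M * N%:R `^ (e + 1)).
  apply: (@le_trans _ _ (\sum_(0 <= n < N) (K * E) `^ s' * n.+1%:R `^ e)).
    have -> : \sum_(x <- Omega) radial_measure D x * `|u x| `^ (p * s') =
        \sum_(x <- index_iota 0 N | x \in Omega) radial_measure D x * `|u x| `^ (p * s').
      rewrite -[RHS]big_filter; apply: perm_big; apply: uniq_perm.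
      - exact: fset_uniq.
      - by rewrite filter_uniq ?iota_uniq.
      - move=> x; rewrite mem_filter mem_index_iota /= andbC.
        by case xO : (x \in Omega); rewrite ?andbF// ltnS outer_radius_ge.
    rewrite big_mkcond; apply: ler_sum_nat => n /andP[_ nN].
    by case: ifP => _; [exact: term|rewrite mulr_ge0 ?powR_ge0].
  rewrite -mulr_sumr ler_wpM2l ?powR_ge0//; apply: sum_powR_le.
  by rewrite -subr_gt0 opprK.
rewrite /lnorm -powRrM invfM mulrAC mulVf ?gt_eqF// mul1r.
apply: le_trans (ler_powR_base _ _ sumO) _.
- by rewrite invr_ge0 ltW.
- by rewrite sumr_ge0// => i _; rewrite mulr_ge0 ?powR_ge0.
rewrite powRM ?mulr_ge0 ?powR_ge0 ?(ltW M0)// (powRM s'^-1 (ltW M0) (powR_ge0 _ _)).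
rewrite -!powRrM mulfV ?gt_eqF// powRr1//.
rewrite expE.
rewrite le_eqVlt; apply/orP; left; apply/eqP; ring.
Qed.

(** Only the lower bound [e] of the denominator is available, so the case of an
    infinite denominator, where the quotient is 0, has to be covered. *)
Lemma lee_ratio (a c e : R) (y : \bar R) : 0 <= c -> 0 < e ->
  (e%:E <= y)%E -> a <= c * e -> (a%:E / y <= c%:E)%E.
Proof.
move=> c0 e0; case: y => [y| |]; rewrite ?lee_fin ?leeNy_eq//.
  move=> ey ace; have y0 : 0 < y by apply: lt_le_trans ey.
  by rewrite inver gt_eqF// lee_pdivrMr// lee_fin (le_trans ace)// ler_wpM2l.
  by rewrite mulr0.
Qed.

End radii.

Theorem proposition3p11 (R : realType) (D : R) (hD : 1 < D) :
  (forall p : R, D < p ->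
     exists C : R, 0 < C /\
       forall Omega : {fset nat}, Omega != fset0 ->
         (2 <= outer_radius Omega)%N ->
         (cap_radius (radial_weight D) p Omega
            <= (C * (outer_radius Omega)%:R `^ (p - D))%:E)%E)
  /\
  (forall p : R, p = D ->
     exists C : R, 0 < C /\
       forall Omega : {fset nat}, Omega != fset0 ->
         (2 <= outer_radius Omega)%N ->
         (cap_radius (radial_weight D) p Omega
            <= (C * ln (outer_radius Omega)%:R `^ (p - 1))%:E)%E)
  /\
  (forall p s : R, 1 < p -> p < D -> D / p < s ->
     exists C : R, 0 < C /\
       forall Omega : {fset nat}, Omega != fset0 ->
         (2 <= outer_radius Omega)%N ->
         (cap_radius_s (radial_weight D) (radial_measure D) p s Omega
            <= (C * (outer_radius Omega)%:R `^ (p - D / s))%:E)%E).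
Proof.
split=> [p Dp|]; last split=> [p pD|p s p1 pD sD].
- have p1 : 1 < p by exact: lt_trans Dp.
  have p10 : 0 < p - 1 by rewrite subr_gt0.
  pose c := - ((D - 1) / (p - 1)).
  have c1 : -1 < c by rewrite ltrN2 ltr_pdivrMr// mul1r ltrD2r.
  have cp : (c + 1) * (p - 1) = p - D by rewrite /c; field; rewrite gt_eqF.
  have M0 : 0 < 1 + (c + 1)^-1.
    by rewrite ltr_pwDl// invr_ge0 -[1]opprK subr_ge0 ltW.
  exists ((1 + (c + 1)^-1) `^ (p - 1) * 2 `^ (p - D)).
  split=> [|Omega _ T2]; first by rewrite mulr_gt0 ?powR_gt0.
  have T0 : (0 < outer_radius Omega)%N by exact: leq_trans T2.
  apply: cap_radius_le => //; first by rewrite !mulr_gt0 ?powR_gt0// ltr0n.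
  apply: le_trans (ler_powR_base (ltW p10) _ (sum_powR_le c _ c1)) _.
    by rewrite sumr_ge0.
  rewrite powRM ?powR_ge0 ?(ltW M0)// -powRrM cp -mulrA ler_wpM2l ?powR_ge0//.
  by rewrite succ_powR_le// subr_ge0 ltW.
- subst p; have D10 : 0 < D - 1 by rewrite subr_gt0.
  have l2 : 0 < ln 2 :> R by rewrite ln_gt0// ltr1n.
  exists ((2 + (ln 2)^-1) `^ (D - 1)).
  have C0 : 0 < 2 + (ln 2)^-1 :> R by rewrite addr_gt0 ?invr_gt0.
  split=> [|Omega _ T2]; first by rewrite powR_gt0.
  set T := outer_radius Omega in T2 *.
  have lT : ln 2 <= ln T%:R :> R.
    by rewrite ler_ln ?posrE ?ltr0n ?ler_nat// (leq_trans _ T2).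
  have lT0 : 0 < ln T%:R :> R by exact: lt_le_trans lT.
  apply: cap_radius_le => //; first by rewrite mulr_gt0 ?powR_gt0.
  rewrite -powRM ?(ltW C0) ?(ltW lT0)// mulfV ?gt_eqF//.
  under eq_bigr do rewrite powR_inv1 ?ler0n//.
  apply: (ler_powR_base (ltW D10)); first by rewrite sumr_ge0.
  apply: le_trans (sum_inv_le_ln _) _; rewrite -/T mulrDl addrC lerD//.
    (* ln (T + 1) <= 2 ln T because T + 1 <= T^2 for T >= 2 *)
    have -> : 2 * ln T%:R = ln (T ^ 2)%:R :> R.
      by rewrite natrX lnXn ?ltr0n ?(leq_trans _ T2)// mulr_natl.
    rewrite ler_ln ?posrE ?ltr0n ?expn_gt0 ?(leq_trans _ T2)// ler_nat.
    by rewrite -mulnn ltn_Pmull ?(leq_trans _ T2).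
  by rewrite ler_pdivlMl// mulr1.
- have [C C0 hC] := lnorm_powR_le D p s p1 pD sD.
  have p0 : 0 < p by rewrite (lt_trans _ p1).
  have D0 : 0 < D by rewrite (lt_trans _ hD).
  have s0 : 0 < s by apply: lt_trans sD; rewrite divr_gt0.
  have ps : 0 <= p - D / s by rewrite subr_ge0 ler_pdivrMr// mulrC -ler_pdivrMr// ltW.
  exists (C * 2 `^ (p - D / s)); split=> [|Omega _ T2]; first by rewrite mulr_gt0 ?powR_gt0.
  have T0 : (0 < outer_radius Omega)%N by exact: leq_trans T2.
  apply: ge_ereal_sup => _ [u [Xu u0] <-].
  set N := (outer_radius Omega).+1.
  (* a function without energy on the first N edges is constantly u N = 0 *)
  have E0 : 0 < edge_energy D p u N.
    rewrite lt_neqAle edge_energy_ge0 andbT eq_sym; apply: contra_notN u0 => /eqP E0.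
    apply/funext => x /=; case xO : (x \in Omega); last by rewrite Xu// xO.
    have xN : (x <= N)%N by rewrite leqW// outer_radius_ge.
    have := powR_normr_le_edge_energy D p u x N p1 (XV_outer_radius _ _ Xu) xN.
    rewrite E0 mulr0 => ux0; apply/normr0_eq0/(@powR_eq0_eq0 _ _ p)/le_anti.
    by rewrite ux0 powR_ge0.
  apply: lee_ratio E0 (le_edge_energy D p u N) _.
    by rewrite !mulr_ge0 ?powR_ge0// ltW.
  apply: le_trans (hC _ _ Xu) _.
  rewrite ler_wpM2r ?edge_energy_ge0// -mulrA ler_wpM2l ?(ltW C0)//.
  exact: succ_powR_le.
Qed.
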